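(* Let $m\ge 3$ and $n\ge 2$. For every positive integer $k$, $$\chi^b_{B_1^*(m,n)}(2k)=\Big[\sum_{i=0}^{m-3}(-1)^i(2k-1)^{(m-2)-i}\Big]\,\chi^b_{B_1^*(m,n-1)}(2k)+(-1)^{m-2}\chi^b_{B_m^{n-1}}(2k).$$
   Context: A signed graph $(G,\sigma)$ is a finite graph $G$ (parallel edges allowed) with a sign function $\sigma:E(G)\to\{+1,-1\}$; its signature is the set of negative edges. A zero-free signed coloring in $2k$ colors is a map $c:V(G)\to\{-k,\dots,-1,1,\dots,k\}$; it is proper if $c(y)\neq\sigma(e)c(x)$ for every edge $e=xy$. The balanced chromatic polynomial $\chi^b_{(G,\sigma)}(2k)$ is the number of proper zero-free signed colorings in $2k$ colors. For integers $m\ge 3$, $n\ge 1$, the Book graph $B(m,n)$ has vertex set $\{u,v\}\cup\{u_j^l:1\le l\le n,\,1\le j\le m-2\}$ and consists of the $n$ cycles $u\,u_1^l\cdots u_{m-2}^l\,v\,u$ sharing the edge $uv$. $B_1^*(m,n)$ denotes $B(m,n)$ with signature $\{uv\}$. The signed graph $B_m^n$ is obtained from $B(m,n)$ with all edges positive by replacing the edge $uv$ with two parallel edges between $u$ and $v$, one positive and one negative. *)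

(* Defs.v *)
From HB Require Import structures.
From mathcomp Require Import all_boot all_order all_algebra.

Set Implicit Arguments.
Unset Strict Implicit.
Unset Printing Implicit Defensive.

Import Order.TTheory GRing.Theory Num.Theory.
Local Open Scope ring_scope.

(* Edges carry an (irrelevant) orientation given by the order of the pair
   [ends e]; parallel edges and loops are allowed. *)
Record mgraph := MGraph {
  vert : finType;
  edge : finType;
  ends : edge -> vert * vert
}.

(* [negative e] encodes the sign: sigma(e) = -1 iff [negative e]. *)
Record sgraph := SGraph {
  underlying :> mgraph;
  negative : pred (edge underlying)
}.

Definition sign (G : sgraph) (e : edge G) : int := (-1) ^+ negative e.

Definition with_signature (G : mgraph) (S : {set edge G}) : sgraph :=
  @SGraph G [pred e | e \in S].

Definition colors (k : nat) : seq int :=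
  [seq - (j%:Z) | j <- iota 1 k] ++ [seq j%:Z | j <- iota 1 k].

Lemma mem_colors (k : nat) (z : int) :
  (z \in colors k) = (z != 0) && (`|z| <= k)%N.
Proof.
rewrite mem_cat; apply/orP/andP => [[] /mapP [j]|[]].
- rewrite mem_iota => /andP [j0 jk] ->.
  by rewrite oppr_eq0 abszN absz_nat -ltnS; split=> //; rewrite -lt0n.
- rewrite mem_iota => /andP [j0 jk] ->.
  by rewrite absz_nat -ltnS; split=> //; rewrite -lt0n.
case: z => [n|n] nz; rewrite ?NegzE ?abszN absz_nat => nk.
  by right; apply/mapP; exists n; rewrite // mem_iota add1n ltnS nk lt0n andbT.
by left; apply/mapP; exists n.+1; rewrite // mem_iota add1n !ltnS leq0n.
Qed.

(* Zero-free signed colorings in 2k colors. *)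
Definition coloring (G : sgraph) (k : nat) : finType :=
  {ffun vert G -> seq_sub (colors k)}.

Definition proper_coloring (G : sgraph) (k : nat) (c : coloring G k) : bool :=
  [forall e : edge G,
     ssval (c (ends e).2) != sign e * ssval (c (ends e).1)].

(* The value at 2k of the balanced chromatic polynomial: the argument is k. *)
Definition chib (G : sgraph) (k : nat) : nat :=
  #|[set c : coloring G k | proper_coloring c]|.

(* [inl false] is u, [inl true] is v, and [inr (l, j)] is u_{j+1}^{l+1}. *)
Definition book_vert (m n : nat) : finType := (bool + 'I_n * 'I_(m - 2))%type.

Definition book_u (m n : nat) : book_vert m n := inl false.
Definition book_v (m n : nat) : book_vert m n := inl true.

(* The j-th vertex, 0 <= j <= m - 1, of the path u u_1^l ... u_{m-2}^l v. *)
Definition book_path (m n : nat) (l : 'I_n) (j : nat) : book_vert m n :=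
  if j is i.+1 then
    if insub i is Some i' then inr (l, i') else book_v m n
  else book_u m n.

(* [None] is the edge uv, and [Some (l, j)] joins the j-th and (j+1)-st
   vertices of the l-th path from u to v. *)
Definition book_edge (m n : nat) : finType := option ('I_n * 'I_(m - 1)).

Definition book_ends (m n : nat) (e : book_edge m n) :
    book_vert m n * book_vert m n :=
  if e is Some (l, j) then (book_path m l j, book_path m l j.+1)
  else (book_u m n, book_v m n).

Definition book (m n : nat) : mgraph := MGraph (@book_ends m n).

Definition book_uv (m n : nat) : edge (book m n) := None.

Definition book1 (m n : nat) : sgraph :=
  @with_signature (book m n) [set book_uv m n].

(* G with all edges positive and the edge e0 replaced by two parallel edges:
   [Some e0] stays positive and [None] is the new, negative, copy of e0. *)
Definition double_edge (G : mgraph) (e0 : edge G) : sgraph :=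
  @with_signature
    (@MGraph (vert G) (option (edge G)) (fun e => ends (odflt e0 e)))
    [set None].

Definition book_double (m n : nat) : sgraph := double_edge (book_uv m n).

(* Main.v *)
Require Import Defs.
From mathcomp Require Import all_boot all_order all_algebra.
From mathcomp Require Import ring.

Import Order.TTheory GRing.Theory Num.Theory.
Local Open Scope ring_scope.

(** Once the colours [a] of [u] and [b] of [v] are fixed, the pages can be
    coloured independently, each in [W a b] ways, where [W a b] counts the proper
    colourings of an all-positive path whose ends are coloured [a] and [b].
    Hence both polynomials are sums of [W a b ^ n] over the pairs [(a, b)]
    allowed by the edges between [u] and [v].  An induction on the length of
    the path gives [W a b = A + [a <> b] (-1) ^ (m - 2)], with [A] the bracket
    of the theorem; expanding one of the [n] factors [W a b] in this way yields
    the recurrence, since excluding [a = b] is the effect of the additional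
    positive edge of [B_m^n]. *)

(** This is [W a b] for a path with [p] interior vertices, whose colours are listed by [t]. *)
Definition path_colorings {C : finType} (p : nat) (a b : C) : nat :=
  (\sum_(t : p.-tuple C) path (fun x y => x != y) a (rcons t b))%N.

Lemma path_colorings0 (C : finType) (a b : C) :
  path_colorings 0 a b = (a != b).
Proof.
rewrite /path_colorings (bigD1 [tuple]) //= big1 ?andbT ?addn0 // => t.
by rewrite (tuple0 t) => /eqP.
Qed.

Lemma path_coloringsS (C : finType) (p : nat) (a b : C) :
  path_colorings p.+1 a b = (\sum_(c | c != a) path_colorings p c b)%N.
Proof.
rewrite /path_colorings pair_big_dep /= [RHS]big_mkcond /=.
rewrite (reindex (fun q : C * p.-tuple C => [tuple of q.1 :: q.2])) /=.
  by apply: eq_bigr => -[c t] _ /=; rewrite andbT eq_sym; case: (c != a).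
exists (fun t => (thead t, [tuple of behead t])) => [[c t] _|t _].
  by congr pair; apply/val_inj.
by rewrite [in RHS](tuple_eta t); apply/val_inj.
Qed.

Definition alternating_sum (x : int) (p : nat) : int :=
  \sum_(0 <= i < p) (-1) ^+ i * x ^+ (p - i)%N.

Lemma alternating_sumS (x : int) (p : nat) :
  alternating_sum x p.+1 = x * alternating_sum x p + (-1) ^+ p * x.
Proof.
rewrite /alternating_sum big_nat_recr //= subSnn expr1 mulr_sumr.
congr (_ + _); apply: eq_big_nat => i /andP[_ ip].
by rewrite subSn ?(ltnW ip) // exprS mulrCA.
Qed.

(** Induction on [p], for all [a] at once, summing over the colour [c] next to [a]: the constant
    part is counted [#|C| - 1] times, and [c != b] holds for [#|C| - 1 - [a <> b]] choices of [c],
    where the minus sign turns [(-1) ^ p] into [(-1) ^ p.+1]. *)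
Lemma path_coloringsE (C : finType) (p : nat) (a b : C) :
  (path_colorings p a b)%:Z =
    alternating_sum (#|C|%:Z - 1) p + (-1) ^+ p * (a != b)%:Z.
Proof.
have card_neq c : \sum_(d : C | d != c) 1 = #|C|%:Z - 1 :> int.
  by rewrite sumr_const cardC1 -subn1 natz subzn // (cardD1 c).
elim: p a => [|p IHp] a.
  by rewrite path_colorings0 /alternating_sum big_geq // add0r mul1r.
rewrite path_coloringsS alternating_sumS -natz natr_sum.
under eq_bigr do rewrite natz IHp.
rewrite big_split /= -mulr_sumr; set A := alternating_sum _ p.
have -> : \sum_(c | c != a) A = (#|C|%:Z - 1) * A.
  by rewrite -(card_neq a) mulr_suml; apply: eq_bigr => c _; rewrite mul1r.
have -> : \sum_(c | c != a) (c != b)%:Z = #|C|%:Z - 1 - (a != b)%:Z.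
  (* The conditions are exchanged so that, if [a <> b], the term [c = a] can be split off: it is 0
     here and 1 in the count of colours other than [b]. *)
  have -> : \sum_(c | c != a) (c != b)%:Z = \sum_(c | c != b) (c != a)%:Z.
    rewrite big_mkcond [RHS]big_mkcond; apply: eq_bigr => c _.
    by case: (c != a); case: (c != b).
  have [->|ab] := eqVneq a b.
    by rewrite subr0 -(card_neq b); apply: eq_bigr => c ->.
  rewrite -(card_neq b) (bigD1 a) // [in RHS](bigD1 a) //= eqxx add0r addrC.
  by rewrite addrK; apply: eq_bigr => c /andP[_ ->].
rewrite exprS; ring.
Qed.

Section BookColorings.

Variables (m n : nat) (C : finType).
Hypothesis hm : (3 <= m)%N.

(** Pages are positive in both signed graphs, so only equality of colours matters and [C] can be any
    finite type. *)
Definition page_proper (c : {ffun book_vert m n -> C}) (l : 'I_n) : bool :=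
  [forall j : 'I_(m - 1), c (book_path m l j.+1) != c (book_path m l j)].

Definition book_coloring (q : C * C * {ffun 'I_n -> (m - 2).-tuple C}) :
    {ffun book_vert m n -> C} :=
  [ffun x => match x with
             | inl false => q.1.1
             | inl true => q.1.2
             | inr (l, j) => tnth (q.2 l) j
             end].

Lemma book_coloring_bij : bijective book_coloring.
Proof.
exists (fun c : {ffun book_vert m n -> C} =>
         (c (book_u m n), c (book_v m n), [ffun l => [tuple c (inr (l, j)) | j < m - 2]])).
  case=> -[a b] F; rewrite !ffunE; congr (_, _); apply/ffunP => l.
  by rewrite ffunE; apply: eq_from_tnth => j; rewrite tnth_mktuple ffunE.
move=> c; apply/ffunP => -[[]|[l j]]; rewrite ffunE //=.
by rewrite ffunE tnth_mktuple.
Qed.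

(** The bound on [j] keeps [nth] off its default: past the end, [book_path] stays at v. *)
Lemma book_coloring_path a b F l j : (j < m)%N ->
  book_coloring (a, b, F) (book_path m l j) = nth a (a :: rcons (F l) b) j.
Proof.
case: j => [|j] jm; rewrite ffunE //=.
rewrite nth_rcons size_tuple; case: insubP => [i -> ij|].
  by rewrite -ij (tnth_nth a).
(* No interior vertex is left, so [m - 2 <= j], and [jm] forces equality: the vertex is v. *)
rewrite -leqNgt ltnNge => jp; rewrite jp /=; suff -> : j == (m - 2)%N by [].
by rewrite eqn_leq jp andbT leq_subRL ?(ltnW hm).
Qed.

Lemma page_proper_book_coloring a b F l :
  page_proper (book_coloring (a, b, F)) l =
    path (fun x y => x != y) a (rcons (F l) b).
Proof.
have m1 : (m - 1 = (m - 2).+1)%N by rewrite -subSn ?(ltnW hm) // subSS.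
have m1m j : (j < m - 1)%N -> (j.+1 < m)%N by rewrite ltn_subRL.
apply/forallP/(pathP a) => [H j|H j].
  rewrite size_rcons size_tuple -m1 => jm.
  have := H (Ordinal jm); rewrite !book_coloring_path ?m1m //=; last first.
    by rewrite ltnW ?m1m.
  by rewrite eq_sym.
have jm := ltn_ord j.
rewrite !book_coloring_path ?m1m //; last by rewrite ltnW ?m1m.
by rewrite eq_sym; apply: H; rewrite size_rcons size_tuple -m1.
Qed.

(** The relation [q] stands for the edges between u and v, the only place where the two graphs
    differ. *)
Lemma card_book_colorings (q : rel C) :
  #|[set c : {ffun book_vert m n -> C} |
      q (c (book_u m n)) (c (book_v m n)) && [forall l, page_proper c l]]| =
    (\sum_(ab : C * C | q ab.1 ab.2) path_colorings (m - 2) ab.1 ab.2 ^ n)%N.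
Proof.
rewrite -sum1dep_card big_mkcond (reindex book_coloring) /=; last first.
  exact/onW_bij/book_coloring_bij.
rewrite [RHS]big_mkcond -(pair_bigA _ (fun ab F => if
  q (book_coloring (ab, F) (book_u m n)) (book_coloring (ab, F) (book_v m n)) &&
  [forall l, page_proper (book_coloring (ab, F)) l] then 1%N else 0%N)) /=.
apply: eq_bigr => -[a b] _ /=.
under eq_bigr => F _ do rewrite [book_coloring _ (book_u _ _)]ffunE
  [book_coloring _ (book_v _ _)]ffunE /=.
case: (q a b) => /=; last by rewrite big1.
(* The power is a product over pages; distributivity makes it a sum over families [F] of products of
   0/1 page indicators. *)
rewrite -[in RHS](card_ord n) -prod_nat_const /path_colorings bigA_distr_bigA /=.
apply: eq_bigr => F _; case: forallP => [H|/forallP].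
  by rewrite big1 // => l _; rewrite -page_proper_book_coloring H.
rewrite negb_forall => /existsP[l Hl].
by rewrite (bigD1 l) //= -page_proper_book_coloring (negbTE Hl).
Qed.

End BookColorings.

Lemma card_colors (k : nat) : #|{: seq_sub (colors k)}| = (2 * k)%N.
Proof.
rewrite card_seq_sub; first by rewrite size_cat !size_map size_iota mul2n addnn.
rewrite cat_uniq !map_inj_uniq ?iota_uniq ?andbT //=; first last.
- by move=> i j /oppr_inj [].
- by move=> i j [].
(* The two halves of the list are disjoint: [i = - j] would force [j = 0], hence [i = 0]. *)
apply/hasPn => _ /mapP[i + ->]; rewrite mem_iota => /andP[i0 _].
apply/negP => /mapP[j _] ij.
have : (0 : int) <= - j%:Z by rewrite -ij.
rewrite oppr_ge0 lez_nat leqn0 => /eqP j0; move: ij i0.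
by rewrite j0 oppr0 => -[->].
Qed.

Definition not_opposite {k : nat} : rel (seq_sub (colors k)) :=
  fun a b => ssval b != - ssval a.

Lemma chib_book1 (m n k : nat) : (3 <= m)%N ->
  chib (book1 m n) k =
    (\sum_(ab | @not_opposite k ab.1 ab.2)
       path_colorings (m - 2) ab.1 ab.2 ^ n)%N.
Proof.
move=> hm; rewrite -(card_book_colorings m n _ hm); apply: eq_card => c.
rewrite !inE; apply/forallP/andP => [H|[Huv Hp] [[l j]|]].
- split; first by have := H None; rewrite /sign /= !inE eqxx expr1 mulN1r.
  apply/forallP => l; apply/forallP => j; have := H (Some (l, j)).
  by rewrite /sign /= !inE expr0 mul1r.
- by rewrite /sign /= !inE expr0 mul1r; move/forallP/(_ l)/forallP: Hp; apply.
- by rewrite /sign /= !inE eqxx expr1 mulN1r.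
Qed.

Lemma chib_book_double (m n k : nat) : (3 <= m)%N ->
  chib (book_double m n) k =
    (\sum_(ab | @not_opposite k ab.1 ab.2 && (ab.1 != ab.2))
       path_colorings (m - 2) ab.1 ab.2 ^ n)%N.
Proof.
move=> hm.
rewrite -(card_book_colorings m n _ hm (fun a b => not_opposite a b && (a != b))).
apply: eq_card => c.
(* [None] is the negative copy of uv, [Some None] the positive one, and [Some (Some _)] a page
   edge. *)
rewrite !inE; apply/forallP/andP => [H|[/andP[Huv Huv'] Hp] [[[l j]|]|]].
- split.
    apply/andP; split.
      by have := H None; rewrite /sign /= !inE eqxx expr1 mulN1r.
    by have := H (Some None); rewrite /sign /= !inE expr0 mul1r eq_sym.
  apply/forallP => l; apply/forallP => j; have := H (Some (Some (l, j))).
  by rewrite /sign /= !inE expr0 mul1r.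
- by rewrite /sign /= !inE expr0 mul1r; move/forallP/(_ l)/forallP: Hp; apply.
- by rewrite /sign /= !inE expr0 mul1r eq_sym.
- by rewrite /sign /= !inE eqxx expr1 mulN1r.
Qed.

Theorem theorem7p7 (m n k : nat) (hm : (3 <= m)%N) (hn : (2 <= n)%N)
    (hk : (0 < k)%N) :
  (chib (book1 m n) k)%:Z =
    (\sum_(0 <= i < (m - 2)%N)
        (-1) ^+ i * ((2 * k)%N%:Z - 1) ^+ ((m - 2) - i)%N)
      * (chib (book1 m (n - 1)) k)%:Z
    + (-1) ^+ (m - 2)%N * (chib (book_double m (n - 1)) k)%:Z.
Proof.
rewrite -/(alternating_sum _ _) !chib_book1 // chib_book_double //.
case: n hn => // n _; rewrite subn1 /=.
(* The condition [a != b] moves into the summand, so all three sums range over the same pairs and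
   can be compared termwise. *)
rewrite big_mkcondr -!natz !natr_sum !mulr_sumr -big_split /=.
apply: eq_bigr => -[a b] _ /=.
rewrite expnS natrM [X in X * _]natz path_coloringsE card_colors mulrDl.
by case: (a != b); rewrite ?mulr1 ?mulr0 ?mul0r ?natz.
Qed.
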